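(* Let $H:I\times I\to\mathbb{R}$ and assume that $H$ satisfies $$\min(H(x,y),H(y,z))=H(x,z)\quad\text{and}\quad \max(H(z,y),H(y,x))=H(z,x)$$ for all $x,y,z\in I$ with $x\le y\le z$. Then $$H(x,y)\le\inf_{t\in[x,y]}H(t,t)\quad\text{and}\quad H(y,x)\ge\sup_{t\in[x,y]}H(t,t)$$ for all $x,y\in I$ with $x\le y$. If, in addition, $H$ is continuous at every point of the diagonal $\{(t,t)\mid t\in I\}$, then both of these inequalities hold with equality for all $x,y\in I$ with $x\le y$.
   Context: $I$ is a nonempty open real interval. Continuity at a point of the diagonal means continuity of $H$ as a function of two variables on $I\times I$ at that point. *)

(* Defs.v *)
From mathcomp Require Import all_boot all_order all_algebra.
From mathcomp Require Import all_classical all_reals all_analysis.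
Import Order.TTheory GRing.Theory Num.Theory.
Import numFieldNormedType.Exports.

Set Implicit Arguments.
Unset Strict Implicit.
Unset Printing Implicit Defensive.

Local Open Scope classical_set_scope.
Local Open Scope ring_scope.

(* A function on I x I is represented by a total function on R x R, of which
   only the values on I x I are ever constrained or used. *)

Definition minmax_equations (R : realType) (I : set R) (H : R -> R -> R) :
    Prop :=
  forall x y z : R, I x -> I y -> I z -> x <= y -> y <= z ->
    Num.min (H x y) (H y z) = H x z /\ Num.max (H z y) (H y x) = H z x.

(* Joint continuity, for the topology induced on I x I, at the diagonal. *)
Definition continuous_on_diagonal (R : realType) (I : set R)
    (H : R -> R -> R) : Prop :=
  forall t : R, I t ->
    (fun p : R * R => H p.1 p.2) @ within (I `*` I) (nbhs (t, t)) --> H t t.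

(* The extrema are taken in \bar R: the real-valued inf and sup are 0 on
   unbounded sets, so bounds on them would not entail boundedness. *)
Definition inf_diag (R : realType) (H : R -> R -> R) (x y : R) : \bar R :=
  ereal_inf [set (H t t)%:E | t in `[x, y]].

Definition sup_diag (R : realType) (H : R -> R -> R) (x y : R) : \bar R :=
  ereal_sup [set (H t t)%:E | t in `[x, y]].

(* Main.v *)
(** Along a subdivision point [m] of [a, b], the equation
    [min (H a m) (H m b) = H a b] says that one of the two halves has the same
    value of [H] as the whole. Hence the value [H x y] is attained on arbitrarily
    short subintervals of [x, y] accumulating at some point [t], and continuity
    at [(t, t)] gives [H x y = H t t]; likewise for [H y x] with [max]. *)

Require Import Defs.
From mathcomp Require Import all_boot all_order all_algebra.
From mathcomp Require Import all_classical all_reals all_analysis.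
From mathcomp Require Import lra.
Import Order.TTheory GRing.Theory Num.Theory.
Import numFieldNormedType.Exports.

Local Open Scope classical_set_scope.
Local Open Scope ring_scope.

(** A compactness argument in supremum form: if every point had a neighbourhood on which [P] fails,
    these local failures could be chained along [x, y] by the contrapositive of the splitting
    hypothesis, giving the failure of [P x y]. *)
Lemma subdivision_accumulation (R : realType) (P : R -> R -> Prop) (x y : R) :
  (forall a m b : R, x <= a -> a <= m -> m <= b -> b <= y ->
     P a b -> P a m \/ P m b) ->
  x <= y -> P x y ->
  exists2 t : R, x <= t <= y & forall e : R, 0 < e ->
    exists a b : R, [/\ x <= a <= y, x <= b <= y,
                        `|a - t| < e, `|b - t| < e & P a b].
Proof.
move=> Psplit xy Pxy; apply: contrapT => noacc.
have good t : x <= t <= y -> exists2 e : R, 0 < e & forall a b,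
    x <= a <= y -> x <= b <= y -> `|a - t| < e -> `|b - t| < e -> ~ P a b.
  move=> txy; apply: contrapT => nogood; apply: noacc; exists t => // e e0.
  apply: contrapT => noab; apply: nogood; exists e => // a b axy bxy ae be Pab.
  by apply: noab; exists a, b.
(* [S] collects the endpoints reached by the chaining; the contradiction will be that it reaches
   [y]. *)
pose S := [set s : R | x <= s <= y /\ ~ P x s].
have Sx : S x.
  have xxy : x <= x <= y by rewrite lexx xy.
  have [e e0 eP] := good x xxy.
  by split=> //; apply: eP => //; rewrite subrr normr0.
have Sub : has_ubound S by exists y => s [/andP[]].
have Ssup : has_sup S by split=> //; exists x.
set t := sup S.
have xt : x <= t by exact: ub_le_sup.
have ty : t <= y by apply: ge_sup; [exists x | move=> s [/andP[]]].
have [e e0 eP] := good t (introT andP (conj xt ty)).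
have [a [/andP[xa ay] nPxa] ta] := sup_adherent e0 Ssup.
have at_ : a <= t by apply: ub_le_sup => //; split=> //; rewrite xa.
(* A step past the supremum, cut off at [y]. Both [a] and [b] are within [e] of [t], so [P a b]
   fails; with [~ P x a] this puts [b] in [S]. Then [b <= t] leaves only [b = y]. *)
pose b := Num.min y (t + e / 2).
have tb : t <= b by rewrite le_min ty /=; lra.
have be : b <= t + e / 2 by rewrite ge_min lexx orbT.
have by_ : b <= y by rewrite ge_min lexx.
have nPab : ~ P a b.
  apply: eP; rewrite ?xa ?(le_trans xt tb) //.
  - by rewrite ltr_norml; apply/andP; split; rewrite -/t in ta *; lra.
  - by rewrite ltr_norml; apply/andP; split; lra.
have nPxb : ~ P x b.
  by move=> /(Psplit x a b (lexx x) xa (le_trans at_ tb) by_)[].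
have bt : b <= t.
  by apply: ub_le_sup => //; split=> //; rewrite (le_trans xt tb).
have bE : b = y.
  by move: bt; rewrite /b ge_min => /orP[?|?]; [apply/min_idPl; lra | lra].
by apply: nPxb; rewrite bE.
Qed.

(** The value [c] is taken arbitrarily close to (t, t), so [H t t] differs from it by less than any
    [d > 0]. No order between [a] and [b] is imposed, so this serves on both sides of the
    diagonal. *)
Lemma continuous_on_diagonal_accumulation (R : realType) (I : set R)
    (H : R -> R -> R) (t c : R) :
  continuous_on_diagonal I H -> I t ->
  (forall e : R, 0 < e -> exists a b : R,
     [/\ I a, I b, `|a - t| < e, `|b - t| < e & H a b = c]) ->
  H t t = c.
Proof.
move=> Hcont It acc; apply/eqP; rewrite -subr_eq0 -normr_eq0 eq_le normr_ge0.
rewrite andbT; apply/ler_addgt0Pl => d d0; rewrite addr0.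
move: (Hcont t It) => /cvgrPdist_lt/(_ d d0).
rewrite near_withinE => /nbhs_ballP[e /= e0 eP].
have [a [b [Ia Ib ae be <-]]] := acc e e0.
apply/ltW; apply: (eP (a, b)) => //.
by split; rewrite /ball /= distrC.
Qed.

Section minmax_diagonal.
Variables (R : realType) (I : set R) (H : R -> R -> R).
Hypotheses (I_itv : is_interval I) (H_minmax : minmax_equations I H).

(** Splitting at [t], then splitting [x, t] at its own endpoint [t], makes [H t t] one of the terms
    of the min giving [H x y] and of the max giving [H y x]. *)
Lemma minmax_le_diag (x t y : R) : I x -> I y -> x <= t <= y ->
  H x y <= H t t /\ H t t <= H y x.
Proof.
move=> Ix Iy txy; have It : I t by exact: (I_itv _ _ Ix Iy).
have /andP[xt ty] := txy.
have [<- <-] := H_minmax _ _ _ Ix It Iy xt ty.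
have [<- <-] := H_minmax _ _ _ Ix It It xt (lexx t).
by rewrite !ge_min !le_max !lexx !orbT.
Qed.

Lemma minmax_diag_attained (x y : R) : continuous_on_diagonal I H ->
  I x -> I y -> x <= y ->
  (exists2 t, x <= t <= y & H t t = H x y) /\
  (exists2 t, x <= t <= y & H t t = H y x).
Proof.
move=> Hcont Ix Iy xy.
have Ixy s : x <= s <= y -> I s by exact: (I_itv _ _ Ix Iy).
have eqns a m b : x <= a -> a <= m -> m <= b -> b <= y ->
    Num.min (H a m) (H m b) = H a b /\ Num.max (H b m) (H m a) = H b a.
  move=> xa am mb b_y; apply: H_minmax => //; apply: Ixy; apply/andP; split; lra.
split.
- have [a m b xa am mb b_y <-||t txy acc] :=
    subdivision_accumulation _ (fun a b => H a b = H x y) x y _ xy.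
  + have [<- _] := eqns a m b xa am mb b_y.
    by case: (leP (H a m) (H m b)); [left | right].
  + by [].
  exists t => //.
  apply: (continuous_on_diagonal_accumulation _ _ _ _ _ Hcont (Ixy _ txy)).
  by move=> e /acc[a [b [/Ixy Ia /Ixy Ib ae be Hab]]]; exists a, b.
(* The same argument with the arguments of [H] swapped: a max, too, equals one of its two terms. *)
- have [a m b xa am mb b_y <-||t txy acc] :=
    subdivision_accumulation _ (fun a b => H b a = H y x) x y _ xy.
  + have [_ <-] := eqns a m b xa am mb b_y.
    by case: (leP (H b m) (H m a)); [left | right].
  + by [].
  exists t => //.
  apply: (continuous_on_diagonal_accumulation _ _ _ _ _ Hcont (Ixy _ txy)).
  by move=> e /acc[a [b [/Ixy Ia /Ixy Ib ae be Hab]]]; exists b, a.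
Qed.

End minmax_diagonal.

Theorem theorem3p1 (R : realType) (I : set R) (H : R -> R -> R)
    (I_neq0 : I !=set0) (I_open : open I) (I_itv : is_interval I)
    (H_minmax : minmax_equations I H) :
  (forall x y : R, I x -> I y -> x <= y ->
     ((H x y)%:E <= inf_diag H x y)%E /\ (sup_diag H x y <= (H y x)%:E)%E) /\
  (continuous_on_diagonal I H ->
   forall x y : R, I x -> I y -> x <= y ->
     (H x y)%:E = inf_diag H x y /\ (H y x)%:E = sup_diag H x y).
Proof.
have bounds x y : I x -> I y -> x <= y ->
    ((H x y)%:E <= inf_diag H x y)%E /\ (sup_diag H x y <= (H y x)%:E)%E.
  move=> Ix Iy xy; split.
  - apply: le_ereal_inf_tmp => _ [t txy <-]; rewrite lee_fin.
    by have [] := minmax_le_diag _ _ _ I_itv H_minmax _ _ _ Ix Iy txy.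
  - apply: ge_ereal_sup => _ [t txy <-]; rewrite lee_fin.
    by have [] := minmax_le_diag _ _ _ I_itv H_minmax _ _ _ Ix Iy txy.
split=> // Hcont x y Ix Iy xy.
have [le_inf sup_le] := bounds x y Ix Iy xy.
have [[t txy Ht] [u uxy Hu]] :=
  minmax_diag_attained _ _ _ I_itv H_minmax _ _ Hcont Ix Iy xy.
(* The missing inequalities hold because [H x y] and [H y x] are themselves diagonal values, at [t]
   and [u]. *)
split; apply/eqP; rewrite eq_le.
- by rewrite le_inf -Ht; apply: ereal_inf_lbound; exists t.
- by rewrite sup_le andbT -Hu; apply: ereal_sup_ubound; exists u.
Qed.
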